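(* Let $r\ge 3$ and let $m\ge r$, $f$ be integers with $0\le f\le\binom{m}{r}$. If $(m,f)\notin\{(r,0),(r,1)\}$, then $\sigma_r(m,f)\le 1-\frac{r!}{r^r}$; otherwise $\sigma_r(m,f)=1$.
   Context: An $r$-graph is an $r$-uniform hypergraph. For integers $r\ge 3$, $m$ and $0\le f\le \binom{m}{r}$, let $S_n^r(m,f)$ be the set of integers $e\in\{0,\dots,\binom nr\}$ such that every $n$-vertex $r$-graph with exactly $e$ edges contains an induced sub-hypergraph on $m$ vertices with exactly $f$ edges, and let $\sigma_r(m,f)=\limsup_{n\to\infty}|S_n^r(m,f)|/\binom{n}{r}$. *)

(* Defs.v *)
From mathcomp Require Import all_boot all_order all_algebra.
From mathcomp Require Import reals ereal topology normedtype sequences.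

Set Implicit Arguments.
Unset Strict Implicit.
Unset Printing Implicit Defensive.

Import GRing.Theory.

(* A hypergraph with vertex type T is given by its set of edges. *)
Definition rgraph (r : nat) (T : finType) (G : {set {set T}}) : bool :=
  [forall e in G, #|e| == r].

Definition induced (T : finType) (G : {set {set T}}) (A : {set T}) :
    {set {set T}} :=
  [set e in G | e \subset A].

Definition has_induced (m f : nat) (T : finType) (G : {set {set T}}) : bool :=
  [exists A : {set T}, (#|A| == m) && (#|induced G A| == f)].

(* The candidate edge numbers 0, ..., 'C(n, r) are the elements of
   'I_('C(n, r)).+1. *)
Definition Sset (r n m f : nat) : {set 'I_('C(n, r)).+1} :=
  [set e : 'I_('C(n, r)).+1 |
    [forall G : {set {set 'I_n}},
      (rgraph r G && (#|G| == e)) ==> has_induced m f G]].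

(* The ratio is 0 for the finitely many n < r, where 'C(n, r) = 0. *)
Definition sigma (R : realType) (r m f : nat) : \bar R :=
  limn_esup (fun n => ((#|Sset r n m f|%:R / 'C(n, r)%:R)%R : R)%:E).

(* Main.v *)
(* Apart from (m, f) = (r, 0), (r, 1) we have m > r.  In an r-partite r-graph an
   (r + 1)-set spans at most 2 edges, and for r = 3 a 5-set spans at most 4, so
   by averaging an m-set spans fewer than half of its 'C(m, r) r-subsets unless
   r = 3 and m = 4.  Hence, if f is at least half of 'C(m, r), the pair (m, f) is
   avoided by all subgraphs of the balanced complete r-partite r-graph, which
   realise every e <= (n / r)^r; if f is less than half, their complements avoid
   it.  For r = 3, m = 4 the same works except when f = 2.  The pair (4, 2) is
   avoided by disjoint unions of complete 3-graphs, and a greedy choice of clique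
   sizes realises every e <= (n / 3)^3 in this way for large n. *)

From mathcomp Require Import classical_sets realfun.
From mathcomp Require Import all_boot all_order all_algebra.
From mathcomp Require Import reals ereal topology normedtype sequences.
From mathcomp Require Import zify.
Require Import Defs.

Set Implicit Arguments.
Unset Strict Implicit.
Unset Printing Implicit Defensive.
Import Order.TTheory GRing.Theory Num.Theory numFieldNormedType.Exports.

(** * Edge densities of induced subgraphs, by averaging *)

Lemma exists_subset_card (T : finType) (A : {set T}) k :
  k <= #|A| -> exists2 B : {set T}, B \subset A & #|B| = k.
Proof.
rewrite -bin_gt0 -cards_draws => /card_gt0P[B]; rewrite inE => /andP[sBA /eqP].
by exists B.
Qed.

Lemma card_induced_subset (T : finType) (F G : {set {set T}}) A :
  F \subset G -> #|induced F A| <= #|induced G A|.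
Proof.
move=> /subsetP sFG; apply/subset_leq_card/subsetP => e.
by rewrite !inE => /andP[/sFG -> ->].
Qed.

Section averaging.
Variables (T : finType) (r : nat) (F : {set {set T}}).
Hypothesis rF : rgraph r F.

(** Double counting: an edge inside [A] survives the deletion of [x] exactly for the [#|A| - r]
    vertices [x] of [A] outside it. *)
Lemma sum_card_inducedD1 (A : {set T}) :
  \sum_(x in A) #|induced F (A :\ x)| = (#|A| - r) * #|induced F A|.
Proof.
under eq_bigr => x xA.
  have -> : #|induced F (A :\ x)| = \sum_(e in induced F A | x \notin e) 1.
    rewrite sum1_card; apply: eq_card => e.
    by rewrite !inE [in RHS]unfold_in /= !inE subsetD1 andbA.
  over.
rewrite (exchange_big_dep (mem (induced F A))) /=; last by move=> x e _ /andP[].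
rewrite mulnC -sum_nat_const; apply: eq_bigr => e; rewrite inE => /andP[eF sA].
transitivity #|A :\: e|.
  by rewrite -sum1_card; apply: eq_bigl => x; rewrite !inE eF sA andbC.
by rewrite cardsD (setIidPr sA); move/forall_inP: rF => /(_ _ eF)/eqP ->.
Qed.

(** The density of [A] is the average of the densities of the sets [A :\ x], so a bound [N / D]
    passes from [m]-sets to all larger sets by induction on the size. *)
Lemma induced_density_le (N D m : nat) : r <= m ->
  (forall A : {set T}, #|A| = m -> #|induced F A| * D <= N * 'C(m, r)) ->
  forall A : {set T}, m <= #|A| -> #|induced F A| * D <= N * 'C(#|A|, r).
Proof.
move=> rm base A; move: {2}#|A| (erefl #|A|) => k.
elim: k A => [|k IH] A kA mA;
  first by have Am : #|A| = m by [lia]; rewrite Am base.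
have [|m_neq] := eqVneq #|A| m; first by move=> Am; rewrite Am; exact: base.
rewrite -(@leq_pmul2l (#|A| - r)); last by lia.
rewrite mulnA -sum_card_inducedD1 [leqRHS]mulnCA -mul_bin_down mulnCA.
rewrite -sum_nat_const big_distrl /=; apply: leq_sum => x xA.
have Ax : #|A :\ x| = k by move: kA; rewrite (cardsD1 x) xA => -[].
by rewrite kA /= -Ax; apply: IH => //; lia.
Qed.

End averaging.

(** * Complete [r]-partite [r]-graphs *)

(** The complete [r]-partite [r]-graph whose parts are the fibres of [p]: an [r]-set whose image has
    size [r] meets each part exactly once. *)
Definition transversals (r : nat) (T : finType) (p : T -> 'I_r) : {set {set T}} :=
  [set e : {set T} | (#|e| == r) && (#|p @: e| == r)].

Section transversals.
Variables (r : nat) (T : finType) (p : T -> 'I_r).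

Lemma rgraph_transversals : rgraph r (transversals p).
Proof. by apply/forall_inP => e; rewrite inE => /andP[]. Qed.

Lemma transversals_inj e : e \in transversals p -> {in e &, injective p}.
Proof.
rewrite inE => /andP[/eqP er /eqP per].
by apply/imset_injP; rewrite per er.
Qed.

(* Two of the r + 1 vertices share a part, and a transversal misses one of
   these two. *)
Lemma card_transversals_succ (A : {set T}) : #|A| = r.+1 ->
  #|induced (transversals p) A| <= 2.
Proof.
move=> Ar; have : ~~ dinjectiveb p (mem A).
  apply/negP => /dinjectiveP/card_in_imset pA.
  by have := max_card (p @: A); rewrite pA card_ord Ar ltnn.
case/dinjectivePn => u uA [v /andP[/= uv vA] puv].
have sub : induced (transversals p) A \subset [set A :\ u; A :\ v].
  apply/subsetP => e; rewrite inE => /andP[eT sA].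
  have er : #|e| = r by move: eT; rewrite inE => /andP[/eqP].
  have e_eq x : x \in A -> x \notin e -> e = A :\ x.
    move=> xA xe; apply/eqP; rewrite eqEcard subsetD1 sA xe er.
    by have := cardsD1 x A; rewrite xA Ar; lia.
  rewrite !inE; have [ue|/(e_eq _ uA) ->] := boolP (u \in e); last by rewrite eqxx.
  have [ve|/(e_eq _ vA) ->] := boolP (v \in e); last by rewrite eqxx orbT.
  by have := transversals_inj eT ue ve puv => uv'; rewrite uv' eqxx in uv.
by rewrite (leq_trans (subset_leq_card sub))// cards2; case: (_ != _).
Qed.

Lemma card_transversals_density (A : {set T}) : r < #|A| ->
  #|induced (transversals p) A| * r.+1 <= 2 * 'C(#|A|, r).
Proof.
apply: (induced_density_le rgraph_transversals) => // B Br.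
by rewrite binSn leq_mul2r card_transversals_succ.
Qed.

(** Every edge inside [A] is the image of the function that picks its vertex in each part. *)
Lemma card_transversals_prod (A : {set T}) :
  #|induced (transversals p) A| <= \prod_(i < r) #|[set x in A | p x == i]|.
Proof.
pose fam := family (fun i => [set x in A | p x == i]).
have -> : \prod_(i < r) #|[set x in A | p x == i]| = #|fam|.
  by rewrite card_family foldrE big_map big_enum.
have sub : induced (transversals p) A \subset
    [set [set (h : {ffun 'I_r -> T}) i | i : 'I_r] | h in fam].
  apply/subsetP => e; rewrite inE => /andP[eT sA].
  have := eT; rewrite inE => /andP[/eqP er /eqP per].
  have pex i : exists2 x, x \in e & p x == i.
    have : i \in p @: e.
      have /eqP -> : p @: e == setT by rewrite eqEcard subsetT cardsT card_ord per /=.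
      by rewrite inE.
    by case/imsetP => x xe ->; exists x.
  pose s i := s2val (sig2W (pex i)).
  have se i : s i \in e by rewrite /s; case: (sig2W _).
  have ps i : p (s i) = i by rewrite /s; case: (sig2W _) => /= x _ /eqP.
  apply/imsetP; exists [ffun i => s i].
    by apply/familyP => i; rewrite ffunE !inE (subsetP sA _ (se i)) ps eqxx.
  apply/eqP; rewrite eq_sym eqEcard; apply/andP; split.
    by apply/subsetP => x /imsetP[i _ ->]; rewrite ffunE se.
  rewrite card_imset ?card_ord ?er// => i j; rewrite !ffunE => sij.
  by rewrite -(ps i) -(ps j) sij.
exact: leq_trans (subset_leq_card sub) (leq_imset_card _ _).
Qed.

End transversals.

(** Three part sizes with sum 5 have product at most [2 * 2 * 1]. *)
Lemma card_transversals3_5 (T : finType) (p : T -> 'I_3) (A : {set T}) :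
  #|A| = 5 -> #|induced (transversals p) A| <= 4.
Proof.
move=> A5; apply: leq_trans (card_transversals_prod p A) _.
have : #|A| = \sum_(i < 3) #|[set x in A | p x == i]|.
  rewrite -sum1_card (partition_big p xpredT) //=; apply: eq_bigr => i _.
  by rewrite -sum1_card; apply: eq_bigl => x; rewrite inE.
rewrite A5 !big_ord_recl !big_ord0 /=.
move: #|_| #|_| #|_| => a b c.
by case: a => [|[|[|[|[|[|a]]]]]]; case: b => [|[|[|[|[|[|b]]]]]]; lia.
Qed.

(** The density bound [2 / (r + 1)] is below one half for [r >= 4]. For [r = 3] it equals one half,
    and the bound [4 / 10] coming from 5-sets replaces it. *)
Lemma card_transversals_half (r : nat) (T : finType) (p : T -> 'I_r) (A : {set T}) :
  3 <= r -> r < #|A| -> 4 < #|A| ->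
  2 * #|induced (transversals p) A| < 'C(#|A|, r).
Proof.
move=> r3 rA A4; have C0 : 0 < 'C(#|A|, r) by rewrite bin_gt0 ltnW.
have [r4|] := ltnP 3 r.
  have := card_transversals_density p rA; move: #|induced _ _| 'C(_, _) C0; nia.
move=> r3'; have {r3 r3'} rE : r = 3 by lia.
subst r; have := induced_density_le (rgraph_transversals p) (N := 4) (D := 10) (m := 5).
move=> /(_ isT) /(_ _ _ A4) H; suff {}/H : forall B : {set T}, #|B| = 5 ->
  #|induced (transversals p) B| * 10 <= 4 * 'C(5, 3) by lia.
by move=> B B5; rewrite leq_mul2r card_transversals3_5.
Qed.

(** * Avoidable edge numbers from complements and [r]-partite graphs *)

Definition avoidable (r n m f e : nat) : Prop :=
  exists G : {set {set 'I_n}}, [/\ rgraph r G, #|G| = e & ~~ has_induced m f G].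

Lemma avoidable_compl (r n m f e : nat) :
  avoidable r n m ('C(m, r) - f) e -> avoidable r n m f ('C(n, r) - e).
Proof.
move=> [G [rG Ge Gf]]; exists ([set e : {set 'I_n} | #|e| == r] :\: G).
have sG : G \subset [set e : {set 'I_n} | #|e| == r].
  by apply/subsetP => x xG; rewrite inE; apply: (forall_inP rG).
split.
- by apply/forall_inP => x; rewrite !inE => /andP[].
- by rewrite cardsD (setIidPr sG) card_draws card_ord Ge.
- apply: contra Gf => /existsP[A /andP[Am Af]]; apply/existsP; exists A.
  rewrite Am /=; move: Af.
  have -> : induced ([set e : {set 'I_n} | #|e| == r] :\: G) A =
    [set e : {set 'I_n} | e \subset A & #|e| == r] :\: induced G A.
    by apply/setP => x; rewrite !inE; case: (x \in G); case: (x \subset A);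
      rewrite /= ?andbF ?andbT.
  have sGA : induced G A \subset [set e : {set 'I_n} | e \subset A & #|e| == r].
    apply/subsetP => x; rewrite !inE => /andP[/(subsetP sG)]; rewrite inE => -> ->.
    by [].
  rewrite cardsD (setIidPr sGA) cards_draws (eqP Am).
  move=> /eqP <-; rewrite subKn//.
  by have := subset_leq_card sGA; rewrite cards_draws (eqP Am).
Qed.

(** The parts are the residue classes mod [r], each with at least [q] vertices; choosing one of [q]
    vertices in every class gives distinct edges. *)
Lemma card_transversals_modn (r n q : nat) (r0 : 0 < r) : r * q <= n ->
  q ^ r <= #|transversals (fun x : 'I_n => Ordinal (ltn_pmod x r0))|.
Proof.
move=> qn; set p := fun x => _.
have lt_n (i : 'I_r) (j : 'I_q) : j * r + i < n.
  have := ltn_ord i; have := ltn_ord j; move: qn; nia.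
(* [v h i] is the vertex number [h i], counted from 0, of the residue class [i]. *)
pose v (h : {ffun 'I_r -> 'I_q}) i : 'I_n := Ordinal (lt_n i (h i)).
have pv h i : p (v h i) = i by apply: val_inj; rewrite /= modnMDl modn_small.
have v_inj h : injective (v h) by apply: can_inj (pv h).
pose V h := [set v h i | i : 'I_r].
have V_inj : injective V.
  move=> h k hk; apply/ffunP => i.
  have : v h i \in V k by rewrite -hk imset_f.
  case/imsetP => j _ /[dup] /(congr1 p); rewrite !pv => <- /(congr1 val)/= /eqP.
  rewrite eqn_add2r eqn_pmul2r// => /eqP ?; exact: val_inj.
have -> : q ^ r = #|[set V h | h : {ffun 'I_r -> 'I_q}]|.
  by rewrite card_imset// card_ffun !card_ord.
apply/subset_leq_card/subsetP => _ /imsetP[h _ ->]; rewrite inE.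
have -> : p @: V h = setT.
  by apply/setP => i; rewrite inE -(pv h i) !imset_f.
by rewrite cardsT card_ord card_imset ?card_ord ?eqxx.
Qed.

Lemma avoidable_rpartite (r n m f e : nat) : 0 < r -> e <= (n %/ r) ^ r ->
  (forall (p : 'I_n -> 'I_r) (A : {set 'I_n}), #|A| = m ->
     #|induced (transversals p) A| < f) ->
  avoidable r n m f e.
Proof.
move=> r0 le_e small.
have qn : r * (n %/ r) <= n by rewrite mulnC leq_trunc_div.
have [G sG Ge] := exists_subset_card (leq_trans le_e (card_transversals_modn r0 qn)).
exists G; split=> //.
  apply/forall_inP => x /(subsetP sG) /(forall_inP (rgraph_transversals _)).
  exact.
apply/existsPn => A; apply/negP => /andP[/eqP Am /eqP Gf].
by have := leq_ltn_trans (card_induced_subset A sG) (small _ _ Am); rewrite Gf ltnn.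
Qed.

(** * Disjoint unions of complete 3-graphs, for the pair (4, 2) *)

(** The disjoint union of the complete 3-graphs on the colour classes of [c] in [V]. Restricting to
    [V] lets cliques be split off one at a time. *)
Definition monochromatic3 (T : finType) (V : {set T}) (c : T -> nat) : {set {set T}} :=
  [set e : {set T} | [&& #|e| == 3, e \subset V &
                        [forall x in e, forall y in e, c x == c y]]].

(* Two distinct triples in a 4-set meet and cover it. *)
Lemma monochromatic3_neq2 (T : finType) (V A : {set T}) (c : T -> nat) :
  #|A| = 4 -> #|induced (monochromatic3 V c) A| != 2.
Proof.
move=> A4; apply/eqP => card2.
have /card_gt1P[d [e []]] : 1 < #|induced (monochromatic3 V c) A| by rewrite card2.
rewrite !inE => /andP[/and3P[/eqP d3 dV dc] dA] /andP[/and3P[/eqP e3 eV ec] eA] de.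
have deA : d :|: e = A.
  apply/eqP; rewrite eqEcard subUset dA eA A4 ltnNge /=; apply: contraNN de => de3.
  have dE : d = d :|: e by apply/eqP; rewrite eqEcard subsetUl d3.
  have eE : e = d :|: e by apply/eqP; rewrite eqEcard subsetUr e3.
  by rewrite dE -eE.
have /card_gt0P[z] : 0 < #|d :&: e|.
  by have := cardsUI d e; rewrite deA A4 d3 e3; lia.
rewrite inE => /andP[zd ze].
have cA x : x \in A -> c x = c z.
  rewrite -deA inE => /orP[xd|xe]; apply/eqP.
    exact: (forall_inP (forall_inP dc _ xd)).
  exact: (forall_inP (forall_inP ec _ xe)).
suff E : induced (monochromatic3 V c) A = [set e : {set T} | e \subset A & #|e| == 3].
  by move: card2; rewrite E cards_draws A4.
apply/setP => t; rewrite !inE andbC; case: (boolP (t \subset A)) => //= tA.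
case: (#|t| == 3) => //=; apply/andP; split.
  by apply: subset_trans tA _; rewrite -deA subUset dV.
apply/forall_inP => x xt; apply/forall_inP => y yt.
by rewrite !cA// (subsetP tA).
Qed.

(* Counting the triples inside the colour classes of V makes e a sum of
   binomials 'C(a, 3) over the class sizes a. *)
Definition clique_sum (k e : nat) : Prop :=
  forall (T : finType) (V : {set T}), k <= #|V| ->
    exists c : T -> nat, #|monochromatic3 V c| = e.

Lemma clique_sum0 : clique_sum 0 0.
Proof.
(* An injective colouring has no monochromatic triple. *)
move=> T V _; exists (fun x => enum_rank x : nat); apply/eqP; rewrite cards_eq0.
apply/eqP/setP => e; rewrite !inE; apply/negbTE/and3P => -[/eqP e3 _ ec].
have /card_gt1P[x [y [xe ye /eqP]]] : 1 < #|e| by rewrite e3.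
by apply; have /eqP/val_inj/enum_rank_inj := forall_inP (forall_inP ec _ xe) _ ye.
Qed.

Lemma clique_sumW (k l e : nat) : k <= l -> clique_sum k e -> clique_sum l e.
Proof. by move=> kl ke T V lV; apply: ke; apply: leq_trans lV. Qed.

Lemma clique_sumD (a k e : nat) :
  clique_sum k e -> clique_sum (a + k) ('C(a, 3) + e).
Proof.
move=> ke T V akV; have [A sAV Aa] := exists_subset_card (leq_trans (leq_addr k a) akV).
have [|c ce] := ke T (V :\: A).
  by rewrite cardsD (setIidPr sAV) Aa; lia.
(* The new clique [A] gets colour 0, and the old colours are shifted to stay distinct from it. *)
exists (fun x => if x \in A then 0 else (c x).+1).
have -> : monochromatic3 V (fun x => if x \in A then 0 else (c x).+1) =
    [set e : {set T} | e \subset A & #|e| == 3] :|: monochromatic3 (V :\: A) c.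
  apply/setP => t; rewrite !inE [in X in X || _]andbC.
  have [t3|] := eqVneq #|t| 3; last by [].
  have /card_gt0P[z zt] : 0 < #|t| by rewrite t3.
  rewrite /=; apply/idP/idP.
    move=> /andP[tV /forall_inP tc]; have [zA|zA] := boolP (z \in A).
      apply/orP; left; apply/subsetP => x xt.
      by have := forall_inP (tc _ zt) _ xt; rewrite zA; case: ifP.
    apply/orP; right; apply/andP.
    have tA x : x \in t -> x \notin A.
      by move=> xt; have := forall_inP (tc _ zt) _ xt; rewrite (negbTE zA); case: ifP.
    split.
      by apply/subsetP => x xt; rewrite inE tA// (subsetP tV).
    apply/forall_inP => x xt; apply/forall_inP => y yt.
    by have := forall_inP (tc _ xt) _ yt; rewrite (negbTE (tA _ xt)) (negbTE (tA _ yt)).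
  case/orP => [tA|/andP[tVA /forall_inP tc]]; apply/andP; split.
  - exact: subset_trans sAV.
  - by apply/forall_inP => x xt; apply/forall_inP => y yt; rewrite !(subsetP tA).
  - by apply: subset_trans tVA (subsetDl _ _).
  - have tA x : x \in t -> x \notin A by move=> /(subsetP tVA); rewrite inE => /andP[].
    apply/forall_inP => x xt; apply/forall_inP => y yt.
    by rewrite (negbTE (tA _ xt)) (negbTE (tA _ yt)) eqSS; apply: (forall_inP (tc _ xt)).
rewrite cardsU cards_draws Aa ce.
suff /eqP -> : [set e : {set T} | e \subset A & #|e| == 3] :&: monochromatic3 (V :\: A) c
    == set0 by rewrite cards0 subn0.
rewrite -subset0; apply/subsetP => t; rewrite !inE.
move=> /andP[/andP[tA /eqP t3] /and3P[_ tVA _]].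
have /card_gt0P[z zt] : 0 < #|t| by rewrite t3.
by have := subsetP tVA _ zt; rewrite inE (subsetP tA).
Qed.

Lemma clique_sum_triples (e : nat) : clique_sum (3 * e) e.
Proof.
elim: e => [|e IH]; first exact: clique_sum0.
by have := clique_sumD (a := 3) IH; rewrite binn add1n -mulnS.
Qed.

Lemma bin3E (a : nat) : 6 * 'C(a.+2, 3) = a.+2 * a.+1 * a.
Proof. by rewrite mulnC (bin_ffact _ 3) !ffactnS ffactn0 /= muln1 mulnA. Qed.

Lemma bin2E (a : nat) : 2 * 'C(a.+1, 2) = a.+1 * a.
Proof. by rewrite mulnC (bin_ffact _ 2) !ffactnS ffactn0 /= muln1. Qed.

(* Greedy choice of the largest clique leaves fewer than 'C(a, 2) edges, to be
   placed in cliques of at most a / 4 vertices. *)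
Lemma clique_sum_greedy : exists K, forall a e k,
  e < 'C(a.+1, 3) -> 4 * a + K <= 3 * k -> clique_sum k e.
Proof.
(* The coefficients 4 and 3 reflect [a + a / 4 + a / 16 + ... = 4 * a / 3], the total size of the
   cliques. The constant pays for the base case [a <= 400], where [e < 'C(401, 3)] disjoint triples
   use [3 * e] vertices. *)
exists (9 * 'C(401, 3)); elim/ltn_ind => a IH e k ea ak.
have [a400|a400] := leqP a 400.
  refine (clique_sumW _ (@clique_sum_triples e)).
  have : 'C(a.+1, 3) <= 'C(401, 3) by apply: leq_bin2l.
  by move: ak ea; move: 'C(401, 3) => D; lia.
have [ea'|ea'] := ltnP e 'C(a, 3).
  by apply: (IH a.-1) => //; [lia|rewrite prednK//; lia|lia].
rewrite -(subnKC ea'); refine (@clique_sumW (a + (k - a)) k _ _ _); first by lia.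
refine (clique_sumD _); apply: (IH (a %/ 4)); [by lia| |by lia].
(* Pascal's rule bounds the remainder; since [a > 400], the cubic ['C(a %/ 4 + 1, 3)] exceeds the
   quadratic ['C(a, 2)]. *)
have : e - 'C(a, 3) < 'C(a, 2) by move: ea; rewrite binS; lia.
move=> /leq_trans; apply.
have [b bE] : exists b, (a %/ 4).+1 = b.+2 by exists (a %/ 4).-1; lia.
have [d dE] : exists d, a = d.+1 by exists a.-1; lia.
have := bin3E b; rewrite -bE; have := bin2E d; rewrite -dE.
by move: 'C(a, 2) 'C(_, 3); nia.
Qed.

Lemma avoidable_cliques : exists N, forall n e,
  N <= n -> e <= (n %/ 3) ^ 3 -> avoidable 3 n 4 2 e.
Proof.
have [K cK] := clique_sum_greedy; exists (9 * K + 9) => n e Nn le_e.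
(* With [q = n %/ 3], starting at [a = 2 * q] works: ['C(2 * q + 1, 3) = (4 * q ^ 3 - q) / 3]
   exceeds [q ^ 3] for [q >= 2], while [8 * q + K <= 3 * n] for large [n]. *)
have [|||c ce] := cK (2 * (n %/ 3)) e n _ _ 'I_n setT; last 1 first.
- exists (monochromatic3 setT c); split=> //.
    by apply/forall_inP => t; rewrite inE => /and3P[].
  apply/existsPn => A; apply/negP => /andP[/eqP/monochromatic3_neq2 H /eqP].
  by apply/eqP.
- apply: leq_ltn_trans le_e _.
  have [q qE] : exists q, n %/ 3 = q.+1 by exists (n %/ 3).-1; lia.
  have q1 : 0 < q by lia.
  rewrite qE; have := bin3E (2 * q + 1).
  have -> : (2 * q.+1).+1 = (2 * q + 1).+2 by lia.
  by rewrite !expnS expn0; move: 'C(_, _); nia.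
- by lia.
- by rewrite cardsT card_ord.
Qed.

(** * Counting the edge numbers in [Sset] *)

Lemma avoidable_notin_Sset r n m f (e : 'I_('C(n, r)).+1) :
  avoidable r n m f e -> e \notin Sset r n m f.
Proof.
move=> [G [rG Ge Gf]]; rewrite inE; apply/forallPn; exists G.
by rewrite negb_imply rG Ge eqxx.
Qed.

(** The [g + 1] avoidable edge numbers lie at the bottom of the range, or at its top if [b] holds,
    and are removed from ['C(n, r) + 1] candidates. *)
Lemma card_Sset_le r n m f g (b : bool) : g <= 'C(n, r) ->
  (forall e, e <= g -> avoidable r n m f (if b then 'C(n, r) - e else e)) ->
  #|Sset r n m f| <= 'C(n, r) - g.
Proof.
move=> gC av.
have lt (e : 'I_g.+1) : (if b then 'C(n, r) - e else e) < 'C(n, r).+1.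
  by have := ltn_ord e; case: b {av} => /=; lia.
pose phi (e : 'I_g.+1) : 'I_('C(n, r)).+1 := Ordinal (lt e).
have phi_inj : injective phi.
  move=> x y /(congr1 val)/=; have := ltn_ord x; have := ltn_ord y.
  by case: b {av lt phi} => ? ? H; apply: val_inj => /=; lia.
have : #|codom phi| <= #|~: Sset r n m f|.
  apply/subset_leq_card/subsetP => _ /codomP[e ->]; rewrite inE.
  by apply: avoidable_notin_Sset; apply: av; rewrite -ltnS ltn_ord.
rewrite card_codom// card_ord.
by have := cardsC (Sset r n m f); rewrite card_ord; lia.
Qed.

Lemma has_induced_edge (r n : nat) (G : {set {set 'I_n}}) (e : {set 'I_n}) :
  rgraph r G -> #|e| = r -> has_induced r (e \in G) G.
Proof.
move=> rG er; apply/existsP; exists e; rewrite er eqxx /=.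
have -> : induced G e = if e \in G then [set e] else set0.
  apply/setP => d; rewrite inE; have [dG|dG] /= := boolP (d \in G).
    have dr : #|d| = r by apply/eqP/(forall_inP rG).
    have -> : (d \subset e) = (d == e) by rewrite eqEcard dr er leqnn andbT.
    by case: eqP => [<-|/eqP/negbTE de]; [rewrite dG inE eqxx|case: ifP; rewrite inE].
  by case: ifP => eG; rewrite inE//; apply/esym; apply: contraNF dG => /eqP ->.
by case: ifP; rewrite ?cards1 ?cards0.
Qed.

Lemma avoidable_set0 (r n : nat) : avoidable r n r 1 0.
Proof.
exists set0; rewrite cards0; split=> //.
  by apply/forall_inP => e; rewrite inE.
apply/existsPn => A; rewrite negb_and; apply/orP; right.
suff -> : induced set0 A = set0 by rewrite cards0.
by apply/setP => e; rewrite !inE.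
Qed.

(** With [b] read as 0 or 1, exactly one edge number is lost: only the empty [r]-graph avoids (r,
    1), and only the complete one avoids (r, 0). *)
Lemma card_Sset_r (r n : nat) (b : bool) : #|Sset r n r b| = 'C(n, r).
Proof.
pose e0 : 'I_('C(n, r)).+1 := if b then ord0 else ord_max.
suff -> : Sset r n r b = [set~ e0] by rewrite cardsC1 card_ord.
apply/setP => e; rewrite in_setC1; apply/idP/idP.
  apply: contraTneq => ->; apply: avoidable_notin_Sset; rewrite /e0.
  case: b {e0}; first exact: avoidable_set0.
  rewrite /= -[X in avoidable _ _ _ _ X]subn0; apply: avoidable_compl.
  by rewrite binn subn0; exact: avoidable_set0.
move=> ee0; rewrite inE; apply/forallP => G; apply/implyP => /andP[rG /eqP Ge].
have [d dr <-] : exists2 d : {set 'I_n}, #|d| = r & (d \in G) = b; last first.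
  exact: has_induced_edge.
move: ee0; rewrite /e0 -val_eqE /= -Ge; case: b {e0} => /=.
  rewrite -lt0n => /card_gt0P[d dG]; exists d => //.
  by apply/eqP/(forall_inP rG).
move=> GC; have /subsetPn[d] : ~~ ([set e : {set 'I_n} | #|e| == r] \subset G).
  apply: contraNN GC => sG; rewrite -[n in 'C(n, _)]card_ord -card_draws.
  rewrite eqn_leq (subset_leq_card sG) andbT; apply/subset_leq_card/subsetP => x xG.
  by rewrite inE; apply: (forall_inP rG).
by rewrite inE => /eqP dr /negbTE dG; exists d.
Qed.

(** * Binomial estimates and passage to the limit *)

Lemma expn_div_le_bin r n : 0 < r -> (n %/ r) ^ r <= 'C(n, r).
Proof.
move=> r0; have qn : r * (n %/ r) <= n by rewrite mulnC leq_trunc_div.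
apply: leq_trans (card_transversals_modn r0 qn) _.
rewrite -[n in leqRHS]card_ord -card_draws; apply/subset_leq_card/subsetP => e.
by rewrite !inE => /andP[].
Qed.

Lemma bin_fact_le_expn r n : 'C(n, r) * r`! <= n ^ r.
Proof.
rewrite bin_ffact ffact_prod -[in leqRHS](card_ord r) -prod_nat_const.
by apply: leq_prod => i _; apply: leq_subr.
Qed.

Local Open Scope ring_scope.
Local Open Scope classical_set_scope.

Section limits.
Variable R : realType.

Lemma limn_esup_le_near (u v : R^nat) (l : R) :
  (\forall n \near \oo, u n <= v n) -> v n @[n --> \oo] --> l ->
  (limn_esup (fun n => (u n)%:E) <= l%:E)%E.
Proof.
move=> uv vl; apply/lee_addgt0Pr => e e0.
have : \forall n \near \oo, u n <= l + e.
  have vle : \forall n \near \oo, v n <= l + e by apply: cvgr_le vl _ _; rewrite ltrDl.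
  by apply: filterS2 uv vle => n; apply: le_trans.
move=> [N _ Nu]; apply: (@le_trans _ _ (ereal_sup ((fun n => (u n)%:E) @` [set n | (N <= n)%N]))).
  (* The upper limit is an infimum of suprema over neighbourhoods of infinity; the tail from [N] is
     one of them. *)
  by apply: ereal_inf_lbound; exists [set n | (N <= n)%N] => //; exists N.
by apply: ge_ereal_sup => _ [n /= Nn <-]; rewrite lee_fin; apply: Nu.
Qed.

(** Since [n - r < r * (n %/ r) <= n], the ratio is squeezed between [1 / r - 1 / n] and [1 / r]. *)
Lemma cvg_divn_ratio (r : nat) : (0 < r)%N ->
  (n %/ r)%:R / n%:R @[n --> \oo] --> (r%:R^-1 : R).
Proof.
move=> r0; have r0R : 0 < r%:R :> R by rewrite ltr0n.
have inv0 : n%:R^-1 @[n --> \oo] --> (0 : R).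
  by rewrite -(cvg_shiftS (fun n => n%:R^-1 : R)); apply: cvg_harmonic.
apply: (@squeeze_cvgr _ _ _ _ (fun n => r%:R^-1 - n%:R^-1) (fun=> r%:R^-1)).
- exists 1%N => // n /= n0; have n0R : 0 < n%:R :> R by rewrite ltr0n.
  have := divn_eq n r; have := ltn_pmod n r0.
  move: (n %/ r)%N (n %% r)%N => q s sr nE.
  rewrite ler_pdivlMr// mulrBl mulVf ?gt_eqF// ler_pdivrMr// ![r%:R^-1 * _]mulrC.
  rewrite ler_pdivlMr// lerBlDr ler_pdivrMr//.
  by rewrite natr1 -!natrM !ler_nat; nia.
- by rewrite -[X in _ --> X]subr0; apply: cvgB => //; apply: cvg_cst.
- exact: cvg_cst.
Qed.

(** The avoided proportion is at least [(n %/ r) ^ r / 'C(n, r)]. By ['C(n, r) <= n ^ r / r!] this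
    is at least [r! * ((n %/ r) / n) ^ r], which tends to [r! / r ^ r]. *)
Lemma sigma_le_avoidable (r m f N : nat) (b : bool) : (0 < r)%N ->
  (forall n e, (N <= n)%N -> (e <= (n %/ r) ^ r)%N ->
     avoidable r n m f (if b then 'C(n, r) - e else e)%N) ->
  (sigma R r m f <= (1 - r`!%:R / (r ^ r)%:R)%:E)%E.
Proof.
move=> r0 av.
apply: (@limn_esup_le_near _ (fun n => 1 - r`!%:R * ((n %/ r)%:R / n%:R) ^+ r)).
  exists (maxn N r) => // n /=; rewrite geq_max => /andP[Nn rn].
  have C0 : 0 < 'C(n, r)%:R :> R by rewrite ltr0n bin_gt0.
  have n0 : 0 < n%:R :> R by rewrite ltr0n (leq_trans r0).
  have qC := expn_div_le_bin n r0.
  have := card_Sset_le qC (fun e => av n e Nn).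
  rewrite -(ler_nat R) natrB// => SC.
  rewrite ler_pdivrMr// (le_trans SC)// mulrBl mul1r lerD2l lerN2.
  rewrite expr_div_n mulrA mulrAC ler_pdivrMr ?exprn_gt0// -!natrX -!natrM ler_nat.
  by have := bin_fact_le_expn r n; move: ('C(_, _)) (_ `!)%N; nia.
apply: cvgB; first exact: cvg_cst.
rewrite natrX -exprVn; apply: cvgMl_tmp.
exact: cvg_comp (cvg_divn_ratio r0) (@exprn_continuous R r _).
Qed.

Lemma sigma_eq1 (r m f : nat) :
  (forall n, (r <= n)%N -> #|Sset r n m f| = 'C(n, r)) -> sigma R r m f = 1%E.
Proof.
move=> SC; rewrite /sigma.
set u := (X in limn_esup X).
suff ul : u @ \oo --> 1%E by have [_ ->] := cvg_limn_einf_sup ul.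
apply: cvg_near_cst; exists r => // n /= rn.
by rewrite /u SC// divff// pnatr_eq0 -lt0n bin_gt0.
Qed.
End limits.

Theorem lemma5p2 (R : realType) (r m f : nat)
    (hr : (3 <= r)%N) (hm : (r <= m)%N) (hf : (f <= 'C(m, r))%N) :
  ((m, f) \notin [:: (r, 0%N); (r, 1%N)] ->
     (sigma R r m f <= (1 - (r`!)%:R / (r ^ r)%:R)%R%:E)%E) /\
  ((m, f) \in [:: (r, 0%N); (r, 1%N)] -> sigma R r m f = 1%E).
Proof.
have r0 : (0 < r)%N by lia.
split; last first.
  rewrite !inE !xpair_eqE => mf; have mr : m = r by case/orP: mf => /andP[/eqP].
  rewrite mr eqxx /= in mf *; apply: sigma_eq1 => n rn.
  by case/orP: mf => /eqP ->; [exact: (card_Sset_r r n false)|exact: (card_Sset_r r n true)].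
rewrite !inE !xpair_eqE => mf.
(* If [m = r], then [f <= 'C(r, r) = 1], which leaves only the two excluded pairs. *)
have rm : (r < m)%N.
  rewrite ltn_neqAle hm andbT; apply: contra mf => /eqP rm.
  by move: hf; rewrite -rm eqxx binn; case: f => [|[]].
have [[-> -> ->]|gen] : (r, m, f) = (3, 4, 2)%N \/ (r, m, f) != (3, 4, 2)%N.
- by case: eqP; [left|right].
- have [N av] := avoidable_cliques.
  exact: (@sigma_le_avoidable _ 3 4 2 N false).
(* The maximum is at least half of ['C(m, r)], so a density below one half suffices when [m > 4].
   Otherwise [r = 3] and [m = 4], and [f != 2] makes the maximum at least 3, against at most 2
   edges. *)
have bound n (p : 'I_n -> 'I_r) (A : {set 'I_n}) : #|A| = m ->
    (#|induced (transversals p) A| < maxn f ('C(m, r) - f))%N.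
  move=> Am; have [m4|m4] := ltnP 4 m.
    have := @card_transversals_half _ _ p A hr; rewrite Am => /(_ rm m4).
    by have := leq_maxl f ('C(m, r) - f); have := leq_maxr f ('C(m, r) - f); lia.
  have rE : r = 3%N by lia.
  have mE : m = 4%N by lia.
  have : (#|induced (transversals p) A| <= 2)%N.
    by apply: card_transversals_succ; rewrite Am mE rE.
  move: #|_| gen => k; rewrite rE mE !xpair_eqE /=.
  by rewrite (_ : 'C(4, 3) = 4)%N //; lia.
(* If [f] attains the maximum, [r]-partite graphs avoid it directly; otherwise their complements
   do. *)
have [fC|fC] := leqP ('C(m, r) - f) f.
  apply: (@sigma_le_avoidable _ r m f 0 false) => // n e _ le_e.
  by apply: avoidable_rpartite => // p A /(bound n p); rewrite (maxn_idPl fC).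
apply: (@sigma_le_avoidable _ r m f 0 true) => // n e _ le_e.
apply: avoidable_compl; apply: avoidable_rpartite => // p A /(bound n p).
by rewrite (maxn_idPr (ltnW fC)).
Qed.
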